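(* Let $V$ be a finite set with a topology $\mathcal D$, for each $v\in V$ let $\Omega_v$ be a nonempty preordered set, and let $\Theta$ be the presheaf of relative traces. Let $(A,\mathcal U)$ be a specification, i.e. $A\subseteq\Theta$ is a subpresheaf and $\mathcal U$ is a maximal cover of $(V,\mathcal D)$. If $A$ is flasque beneath the cover $\mathcal U$ — that is, for all $W\subseteq W'$ in $\mathcal D$ with $W'\subseteq U$ for some $U\in\mathcal U$, the restriction map $AW'\to AW$ is surjective — then $(A,\mathcal U)$ is locally consistent: for all $U,W\in\mathcal U$, $$\{x|_{U\cap W}: x\in AU\}=\{y|_{U\cap W}: y\in AW\}.$$
   Context: For $U\in\mathcal D$, $\Omega U\defeq\prod_{v\in U}\Omega_v$ with the componentwise preorder. For $n\ge -1$, a $U$-trace of length $n$ is a sequence $x_0\le\dots\le x_n$ of elements of $\Omega U$ (empty when $n=-1$) with $x_i\ne x_{i+1}$ for all $0\le i<n$; $\Theta U$ is the set of all $U$-traces. For $U\subseteq U'$ and $x\in\Theta U'$, $x|_U\in\Theta U$ is obtained by projecting each $x_i$ onto the coordinates in $U$ and collapsing every maximal run of consecutive equal entries to one entry; this makes $\Theta$ a presheaf on $\mathcal D$. A subpresheaf $A\subseteq\Theta$ is a choice of subsets $AU\subseteq\Theta U$ for each $U\in\mathcal D$ closed under restriction ($x\in AU'$, $U\subseteq U'$ implies $x|_U\in AU$). A maximal cover of $(V,\mathcal D)$ is a family of open sets whose union is $V$ and which is an antichain under inclusion. *)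

(* Defs.v *)
From HB Require Import structures.
From mathcomp Require Import all_boot all_order.
From mathcomp Require Import all_classical topology.

Set Implicit Arguments.
Unset Strict Implicit.
Unset Printing Implicit Defensive.

Import Order.TTheory.

Local Open Scope classical_set_scope.
Local Open Scope order_scope.

Record opens (V : topologicalType) := Opens {
  open_set :> set V;
  open_setP : open open_set }.

Definition opensI (V : topologicalType) (U W : opens V) : opens V :=
  Opens (openI (open_setP U) (open_setP W)).

Lemma opensIl (V : topologicalType) (U W : opens V) : opensI U W `<=` U.
Proof. exact: subIsetl. Qed.
Arguments opensIl {V} U W _ _.

Lemma opensIr (V : topologicalType) (U W : opens V) : opensI U W `<=` W.
Proof. exact: subIsetr. Qed.
Arguments opensIr {V} U W _ _.

(** [Omega v] is the preordered set of local states at [v]; [state Omega U] is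
    the product over [v \in U].  A point of [U] is a term of the sigma type
    attached to the set [U]. *)
Definition state (V : topologicalType) (d : Order.disp_t)
    (Omega : V -> preorderType d) (U : opens V) : Type :=
  forall v : U, Omega (val v).

HB.instance Definition _ (V : topologicalType) (d : Order.disp_t)
    (Omega : V -> preorderType d) (U : opens V) :=
  Choice.copy (state Omega U) (forall v : U, Omega (val v)).

Definition state_le (V : topologicalType) (d : Order.disp_t)
    (Omega : V -> preorderType d) (U : opens V) : rel (state Omega U) :=
  fun x y => `[< forall v : U, x v <= y v >].

Lemma state_le_refl (V : topologicalType) (d : Order.disp_t)
    (Omega : V -> preorderType d) (U : opens V) :
  reflexive (@state_le V d Omega U).
Proof. by move=> x; apply/asboolP => v; exact: lexx. Qed.

Lemma state_le_trans (V : topologicalType) (d : Order.disp_t)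
    (Omega : V -> preorderType d) (U : opens V) :
  transitive (@state_le V d Omega U).
Proof.
move=> y x z /asboolP xy /asboolP yz; apply/asboolP => v.
exact: le_trans (xy v) (yz v).
Qed.

HB.instance Definition _ (V : topologicalType) (d : Order.disp_t)
    (Omega : V -> preorderType d) (U : opens V) :=
  @Order.Le_isPreorder.Build d (state Omega U) (@state_le V d Omega U)
    (@state_le_refl V d Omega U) (@state_le_trans V d Omega U).

(** Since [<=] is only a preorder, this is weaker than [x < y], which means
    [x <= y] and not [y <= x]. *)
Definition step (d : Order.disp_t) (T : preorderType d) : rel T :=
  fun x y => (x <= y) && (x != y).

(** A trace of length [n] is a sequence with [n.+1] entries; the empty
    sequence is the trace of length -1. *)
Record trace (V : topologicalType) (d : Order.disp_t)
    (Omega : V -> preorderType d) (U : opens V) := Trace {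
  trace_seq :> seq (state Omega U);
  trace_sorted : sorted (@step d (state Omega U)) trace_seq }.

Lemma trace_inj (V : topologicalType) (d : Order.disp_t)
    (Omega : V -> preorderType d) (U : opens V) :
  injective (@trace_seq V d Omega U).
Proof.
move=> [s hs] [t ht] /= st; move: ht; rewrite -st => ht.
by rewrite (bool_irrelevance hs ht).
Qed.

(** An entry is dropped when it equals its successor, so every maximal run of
    equal consecutive entries leaves exactly one entry. *)
Fixpoint collapse (T : eqType) (s : seq T) : seq T :=
  if s is x :: s' then
    if ohead s' == Some x then collapse s' else x :: collapse s'
  else [::].

Lemma ohead_collapse (T : eqType) (s : seq T) : ohead (collapse s) = ohead s.
Proof. by elim: s => //= x s IHs; case: eqP => //; rewrite IHs. Qed.

Lemma collapse_cons2 (T : eqType) (x y : T) (s : seq T) :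
  collapse [:: x, y & s] =
  if y == x then collapse (y :: s) else x :: collapse (y :: s).
Proof. by []. Qed.

Lemma collapse_sorted (d : Order.disp_t) (T : preorderType d) (s : seq T) :
  sorted <=%O s -> sorted (@step d T) (collapse s).
Proof.
elim: s => // x [//|y s] IHs /andP[xy ys]; rewrite collapse_cons2.
move: (ohead_collapse (y :: s)) (IHs ys).
case: eqVneq => // yNx; case: (collapse (y :: s)) => //= z t [->] ->.
by rewrite /step xy eq_sym yNx.
Qed.

Lemma collapse_id (d : Order.disp_t) (T : preorderType d) (s : seq T) :
  sorted (@step d T) s -> collapse s = s.
Proof.
elim: s => // x [//|y s] IHs sxy; rewrite collapse_cons2.
move: sxy => /andP[/andP[_ xNy] ys].
by rewrite eq_sym (negbTE xNy) IHs.
Qed.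

Lemma collapse_map (T T' : eqType) (f : T -> T') (s : seq T) :
  collapse (map f (collapse s)) = collapse (map f s).
Proof.
have oheadE t : ohead (map f t) = omap f (ohead t) by case: t.
elim: s => //= x s IHs; rewrite oheadE.
by case: eqP => [->|_] /=; rewrite ?eqxx // oheadE ohead_collapse IHs.
Qed.

Definition state_restrict (V : topologicalType) (d : Order.disp_t)
    (Omega : V -> preorderType d) (U U' : opens V) (sUU' : U `<=` U')
    (x : state Omega U') : state Omega U :=
  fun v => x (subfun sUU' v).

Lemma restrict_sorted (V : topologicalType) (d : Order.disp_t)
    (Omega : V -> preorderType d) (U U' : opens V) (sUU' : U `<=` U')
    (x : trace Omega U') :
  sorted (@step d (state Omega U))
    (collapse (map (state_restrict sUU') x)).
Proof.
apply: collapse_sorted; rewrite sorted_map.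
apply: sub_sorted (trace_sorted x) => a b /andP[/asboolP ab _].
by apply/asboolP => v; exact: ab.
Qed.

Definition restrict (V : topologicalType) (d : Order.disp_t)
    (Omega : V -> preorderType d) (U U' : opens V) (sUU' : U `<=` U')
    (x : trace Omega U') : trace Omega U :=
  Trace (restrict_sorted sUU' x).

Lemma restrict_id (V : topologicalType) (d : Order.disp_t)
    (Omega : V -> preorderType d) (U : opens V) (sUU : U `<=` U)
    (x : trace Omega U) :
  restrict sUU x = x.
Proof.
apply: trace_inj => /=; rewrite -[RHS](collapse_id (trace_sorted x)).
congr collapse; rewrite -[RHS]map_id; apply: eq_map => y.
apply: functional_extensionality_dep => -[v Uv] /=.
by rewrite /state_restrict /subfun /=; congr (y (exist _ v _)); exact: bool_irrelevance.
Qed.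

Lemma restrict_comp (V : topologicalType) (d : Order.disp_t)
    (Omega : V -> preorderType d) (U U' U'' : opens V) (sUU' : U `<=` U')
    (sU'U'' : U' `<=` U'') (sUU'' : U `<=` U'') (x : trace Omega U'') :
  restrict sUU' (restrict sU'U'' x) = restrict sUU'' x.
Proof.
apply: trace_inj => /=; rewrite collapse_map -map_comp.
congr collapse; apply: eq_map => y.
apply: functional_extensionality_dep => -[v Uv] /=.
by rewrite /state_restrict /subfun /=; congr (y (exist _ v _)); exact: bool_irrelevance.
Qed.

Record subpresheaf (V : topologicalType) (d : Order.disp_t)
    (Omega : V -> preorderType d) := Subpresheaf {
  sections :> forall U : opens V, set (trace Omega U);
  sections_restrict : forall (U U' : opens V) (sUU' : U `<=` U'),
    set_fun (@sections U') (@sections U) (restrict sUU') }.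
Arguments sections {V d Omega} A U : rename.

Definition maximal_cover (V : topologicalType) (C : set (opens V)) : Prop :=
  cover C (@open_set V) = [set: V] /\
  (forall U W : opens V, C U -> C W -> U `<=` W -> U = W).

Record specification (V : topologicalType) (d : Order.disp_t)
    (Omega : V -> preorderType d) := Specification {
  spec_sub : subpresheaf Omega;
  spec_cover : set (opens V);
  spec_coverP : maximal_cover spec_cover }.

Definition flasque_beneath (V : topologicalType) (d : Order.disp_t)
    (Omega : V -> preorderType d) (A : subpresheaf Omega)
    (C : set (opens V)) : Prop :=
  forall (W W' : opens V) (sWW' : W `<=` W'),
    (exists2 U : opens V, C U & W' `<=` U) ->
    set_surj (A W') (A W) (restrict sWW').

Definition locally_consistent (V : topologicalType) (d : Order.disp_t)
    (Omega : V -> preorderType d) (S : specification Omega) : Prop :=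
  forall U W : opens V, spec_cover S U -> spec_cover S W ->
    restrict (opensIl U W) @` spec_sub S U =
    restrict (opensIr U W) @` spec_sub S W.

(* Main.v *)
Require Import Defs.
From mathcomp Require Import all_boot all_order.
From mathcomp Require Import all_classical topology.

Local Open Scope classical_set_scope.

(** Both images equal [A (opensI U W)]: traces of [A] over a cover member restrict into [A] because
    [A] is a subpresheaf, and flasqueness makes this restriction surjective. [flasque_beneath_image]
    gives this for any open subset of one cover member. *)

Lemma flasque_beneath_image {V : topologicalType} {d : Order.disp_t}
    {Omega : V -> preorderType d} {A : subpresheaf Omega} {C : set (opens V)}
    {U W : opens V} (sWU : W `<=` U) :
  flasque_beneath A C -> C U -> Defs.restrict sWU @` A U = A W.
Proof.
move=> flasqueA CU; apply: surj_image_eq.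
  by move=> _ [x Ax <-]; exact: sections_restrict.
(* The larger open set is [U] itself, so [U] also serves as the cover member containing it. *)
by apply: flasqueA; exists U.
Qed.

Theorem theorem5 (V : topologicalType) (V_finite : finite_set [set: V])
    (d : Order.disp_t) (Omega : V -> preorderType d)
    (Omega_nonempty : forall v : V, [set: Omega v] !=set0)
    (S : specification Omega) :
  flasque_beneath (spec_sub S) (spec_cover S) -> locally_consistent S.
Proof.
move=> flasqueS U W CU CW.
by rewrite (flasque_beneath_image _ flasqueS CU)
  (flasque_beneath_image _ flasqueS CW).
Qed.
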